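(* Let $k$ be a positive integer, let $G$ be a connected graph, let $a_1, \dotsc, a_n$ be an ordering of the vertices of $G$, and let $\widetilde{G}$ be the graph constructed from $k$, $G$ and this ordering as described in the context. Suppose that $\widetilde{G}$ has a tree decomposition $(T, \mathcal{B})$ of width at most $k$ such that $T$ is a spanning tree of $\widetilde{G}$. Then there exists a tree decomposition $(T', \mathcal{B}')$ of $G$ of width at most $k+1$ such that $T'$ is a spanning tree of $G$ and for every $v \in V(G)$, we have $v \in V(T'_v)$ (equivalently, $v \in B'_v$ for every $v \in V(G) = V(T')$).
   Context: Graphs are finite and simple. Tree decompositions. Let $H$ be a graph, $T$ a tree, and $\mathcal{B} = \{B_x : x \in V(T)\}$ a family of subsets of $V(H)$ indexed by the vertices of $T$. For $v \in V(H)$ let $T_v := T[\{x \in V(T) : v \in B_x\}]$. Then $(T,\mathcal{B})$ is a tree decomposition of $H$ if (i) each $T_v$ is a non-empty subtree (connected acyclic subgraph) of $T$, and (ii) for every $uv \in E(H)$, $V(T_u) \cap V(T_v) \neq \emptyset$. Its width is $\max_{x \in V(T)} |B_x| - 1$. When $T$ is a spanning tree of $H$, the vertices of $T$ (indexing the bags) are the vertices of $H$ themselves, so the condition $v \in V(T_v)$ makes sense. For $(T',\mathcal{B}')$ with $\mathcal{B}' = \{B'_x : x \in V(T')\}$, the subtree $T'_v$ is defined analogously as $T'[\{x \in V(T') : v \in B'_x\}]$. Construction of $\widetilde{G}$. Fix a positive integer $k$, a graph $G$, and an ordering $a_1, \dotsc, a_n$ of $V(G)$ (so $n = |V(G)|$).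 Define integers $h_1 := 2$ and $h_j := (k+2)^{2h_{j-1}} + 1$ for $2 \le j \le n$. Define integers $w_n, w_{n-1}, \dotsc, w_1$ and rooted trees $S_n, S_{n-1}, \dotsc, S_1$ recursively, in decreasing order of index: $w_n := (k+1)n + 1$; given $w_j$, $S_j$ is the complete rooted $w_j$-ary tree of height $h_j$ (every vertex at distance less than $h_j$ from the root has exactly $w_j$ children, and the leaves are exactly the vertices at distance $h_j$ from the root); and given $S_n, \dotsc, S_{j+1}$, $$w_j := (k+1)\Bigl(n + \sum_{i=j+1}^n |V(S_i)|\Bigr) + 1.$$ Finally, $\widetilde{G}$ is obtained from the disjoint union of $G, S_1, \dotsc, S_n$ by identifying, for each $j \in \{1,\dotsc,n\}$, the vertex $a_j$ with the root of $S_j$. *)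

(* Defs.v *)
From HB Require Import structures.
From mathcomp Require Import all_boot.

Set Implicit Arguments.
Unset Strict Implicit.
Unset Printing Implicit Defensive.

Record sgraph (V : finType) := SGraph {
  adj : rel V;
  adj_sym : symmetric adj;
  adj_irr : irreflexive adj }.

(* The empty graph counts as connected, hence as a tree; non-emptiness is
   required separately where it matters. *)
Definition connected (V : finType) (G : sgraph V) : Prop :=
  forall x y : V, connect (adj G) x y.

(* The ucycles of length at most 2 are the empty one and those that traverse
   an edge back and forth. *)
Definition acyclic (V : finType) (G : sgraph V) : Prop :=
  forall c : seq V, ucycle (adj G) c -> size c <= 2.

Definition is_tree (V : finType) (G : sgraph V) : Prop :=
  connected G /\ acyclic G.

Definition spanning_tree (V : finType) (T G : sgraph V) : Prop :=
  is_tree T /\ subrel (adj T) (adj G).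

Section Induced.
Variables (V : finType) (G : sgraph V) (S : {set V}).

Definition induced_adj : rel {x | x \in S} :=
  fun x y => adj G (val x) (val y).

Lemma induced_adj_sym : symmetric induced_adj.
Proof. by move=> x y; rewrite /induced_adj adj_sym. Qed.

Lemma induced_adj_irr : irreflexive induced_adj.
Proof. by move=> x; rewrite /induced_adj adj_irr. Qed.

Definition induced : sgraph {x | x \in S} :=
  SGraph induced_adj_sym induced_adj_irr.

End Induced.

(* The vertex set of T_v *)
Definition bag_nodes (U V : finType) (B : U -> {set V}) (v : V) : {set U} :=
  [set x | v \in B x].

Definition tree_decomposition (U V : finType) (T : sgraph U)
    (B : U -> {set V}) (H : sgraph V) : Prop :=
  [/\ is_tree T,
      forall v : V, bag_nodes B v != set0 /\ is_tree (induced T (bag_nodes B v))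
    & forall u v : V, adj H u v -> bag_nodes B u :&: bag_nodes B v != set0].

(* Truncated predecessor: the value is 0 rather than -1 when all bags are
   empty. *)
Definition width (U V : finType) (B : U -> {set V}) : nat :=
  (\max_(x : U) #|B x|).-1.

(* The complete rooted w-ary tree of height h: the vertices are the words of
   length at most h over w letters, the root is the empty word and the
   children of a word are its one-letter extensions. *)

Section CompleteTree.
Variables (w h : nat).

Definition ary_root : h.-bseq 'I_w := [bseq].

Definition ary_child (s t : h.-bseq 'I_w) : bool :=
  [exists c : 'I_w, (t : seq 'I_w) == rcons s c].

Definition ary_adj : rel (h.-bseq 'I_w) :=
  fun s t => ary_child s t || ary_child t s.

Lemma ary_adj_sym : symmetric ary_adj.
Proof. by move=> s t; rewrite /ary_adj orbC. Qed.

Lemma ary_adj_irr : irreflexive ary_adj.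
Proof.
move=> s; rewrite /ary_adj orbb; apply/existsP=> -[c /eqP/(congr1 size)/eqP].
by rewrite size_rcons -[X in X == _]addn0 -addn1 eqn_add2l.
Qed.

Definition ary_tree : sgraph (h.-bseq 'I_w) := SGraph ary_adj_sym ary_adj_irr.

End CompleteTree.

(* Indices are shifted by one: j = 0, ..., n - 1 stands for j + 1. *)

Fixpoint height (k j : nat) : nat :=
  if j is i.+1 then (k + 2) ^ (2 * height k i) + 1 else 2.

Definition arity_of (k n N : nat) : nat := (k + 1) * (n + N) + 1.

(* The total number of vertices of the last m of the trees S_j *)
Fixpoint last_sizes (k n m : nat) : nat :=
  if m is m'.+1 then
    #|{: (height k (n - m)).-bseq 'I_(arity_of k n (last_sizes k n m'))}|
    + last_sizes k n m'
  else 0.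

Definition arity (k n j : nat) : nat := arity_of k n (last_sizes k n (n - j.+1)).

Arguments height : simpl never.
Arguments arity_of : simpl never.
Arguments last_sizes : simpl never.
Arguments arity : simpl never.

Definition S_vertex (k n j : nat) : finType :=
  (height k j).-bseq 'I_(arity k n j).

Definition S_root (k n j : nat) : S_vertex k n j :=
  ary_root (arity k n j) (height k j).

Definition S_tree (k n j : nat) : sgraph (S_vertex k n j) :=
  ary_tree (arity k n j) (height k j).

Lemma arityE (k n j : nat) : j < n ->
  arity k n j = (k + 1) * (n + \sum_(j.+1 <= i < n) #|S_vertex k n i|) + 1.
Proof.
move=> jn; rewrite /arity /arity_of; congr (_ * (_ + _) + _).
have : n - j.+1 <= n by exact: leq_subr.
rewrite -[in X in \sum_(X <= _ < _) _](subKn jn).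
elim: (n - j.+1) => [|m IH] mn; first by rewrite subn0 big_geq.
rewrite big_ltn; last by rewrite -subn_gt0 subKn.
by rewrite -subSn //= subSS -IH 1?ltnW // /S_vertex /arity subnSK // subKn // ltnW.
Qed.

(* The graph G~. When a is a bijection from the indices to V, every vertex a j
   of G is identified with the root of exactly one S_j, so the vertex set of
   G~ is the disjoint union of the vertex sets of the S_j, and a j is
   represented by the root of S_j. *)

Section Tilde.
Variables (k n : nat) (V : finType) (G : sgraph V) (a : 'I_n -> V).

Definition tilde_vertex : finType := {j : 'I_n & S_vertex k n j}.

Definition tilde_root (j : 'I_n) : tilde_vertex :=
  Tagged (fun i : 'I_n => S_vertex k n i) (S_root k n j).

Definition tilde_adj : rel tilde_vertex := fun x y =>
  (tag x == tag y) && adj (S_tree k n (tag x)) (tagged x) (tagged_as x y)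
  || [&& x == tilde_root (tag x), y == tilde_root (tag y)
       & adj G (a (tag x)) (a (tag y))].

Lemma tilde_adj_sym : symmetric tilde_adj.
Proof.
move=> [i s] [j t]; rewrite /tilde_adj /= [adj G _ _]adj_sym andbCA.
congr (_ || _); rewrite [j == i]eq_sym.
have [ij|//] := eqVneq i j; move: t; rewrite -ij => t.
by rewrite !tagged_asE; exact: ary_adj_sym.
Qed.

Lemma tilde_adj_irr : irreflexive tilde_adj.
Proof.
by move=> [i s]; rewrite /tilde_adj /= tagged_asE ary_adj_irr adj_irr !andbF.
Qed.

Definition tilde : sgraph tilde_vertex := SGraph tilde_adj_sym tilde_adj_irr.

Lemma tilde_adj_root (i j : 'I_n) :
  adj tilde (tilde_root i) (tilde_root j) = adj G (a i) (a j).
Proof.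
rewrite /= /tilde_adj /= !eqxx /=.
have [ij|//] := eqVneq i j.
by rewrite -ij tagged_asE ary_adj_irr.
Qed.

Lemma tilde_adj_tree (j : 'I_n) (s t : S_vertex k n j) :
  adj tilde (Tagged (fun i : 'I_n => S_vertex k n i) s)
            (Tagged (fun i : 'I_n => S_vertex k n i) t)
  = adj (S_tree k n j) s t.
Proof. by rewrite [LHS]/= /tilde_adj /= eqxx tagged_asE adj_irr !andbF orbF. Qed.

End Tilde.

(* Main.v *)
(* Take for T' the restriction of T to the roots and add v to the bag B_v.
   Sending all of S_j to a_j maps every edge of T to an edge of T' or to a
   single vertex, so that connected sets of nodes have connected images.
   Everything then follows once each T_{a_j} is known to meet S_j: if T_{a_j}
   leaves S_j it passes through a_j.
   To see this, note that fewer than w_j vertices lie in bags of V(G) or of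
   later trees S_i.  So, starting at a_j, one can walk down S_j along vertices
   that lie in no such bag; their node sets T_v chain up inside a single S_i
   minus its root, with i <= j.  As S_i has height h_i and its bags have size at
   most k+1, it supports paths of fewer than (k+2)^(h_i+1) vertices only, which
   is at most h_j when i < j. Hence i = j, and T_{a_j} meets the node set of the
   first child on the walk. *)

Require Import Defs.
From HB Require Import structures.
From mathcomp Require Import all_boot.

Set Implicit Arguments.
Unset Strict Implicit.
Unset Printing Implicit Defensive.

(** * Connected sets of vertices *)

(** Phrased as an induction principle, so that neither walks nor the subtype of [X] are needed to
    use it. *)
Definition connected_set (U : finType) (e : rel U) (X : {set U}) : Prop :=
  forall P : pred U, {in X &, forall x y, e x y -> P x -> P y} ->
  {in X &, forall x y, P x -> P y}.

Lemma connected_setP (U : finType) (G : sgraph U) (X : {set U}) :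
  connected (induced G X) <-> connected_set (adj G) X.
Proof.
split=> [conX P stepP x y xX yX Px | conX].
  suff walk (u v : {x | x \in X}) :
      connect (adj (induced G X)) u v -> P (val u) -> P (val v).
    exact: (walk (exist _ x xX) (exist _ y yX) (conX _ _) Px).
  move=> /connectP[p].
  elim: p u => [|z p IH] u /= => [_ -> //|/andP[uz pathp] vlast Pu].
  by apply: (IH z) => //; apply: (stepP (val u)) => //; exact: valP.
move=> x y.
(* Reachability from [x] inside [X], extended by [false] outside [X]. *)
pose P u :=
  if insub u is Some u' then connect (adj (induced G X)) x u' else false.
suff : P (val y) by rewrite /P valK.
apply: (conX P _ (val x));
  rewrite ?(valP x) ?(valP y) //; last by rewrite /P valK.
move=> u v uX vX uv; rewrite /P !insubT; move/connect_trans; apply.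
exact: connect1.
Qed.

Lemma connected_setTP (U : finType) (G : sgraph U) :
  connected G <-> connected_set (adj G) [set: U].
Proof.
split=> [conG P stepP x y _ _ Px | conG x y].
  have /connectP[p] := conG x y.
  elim: p x Px => [|z p IH] x Px /= => [_ -> //|/andP[xz pathp] ylast].
  by apply: (IH z) => //; apply: (stepP x).
apply: (conG [pred z | connect (adj G) x z] _ x) => //=.
by move=> u v _ _ uv /connect_trans; apply; exact: connect1.
Qed.

(** A property on the image is pulled back along [f]; an edge that [f] collapses preserves it
    trivially. *)
Lemma connected_set_imset (U W : finType) (e : rel U) (e' : rel W)
    (f : U -> W) (X : {set U}) :
  {in X &, forall x y, e x y -> f x = f y \/ e' (f x) (f y)} ->
  connected_set e X -> connected_set e' (f @: X).
Proof.
move=> fe conX P stepP _ _ /imsetP[x xX ->] /imsetP[y yX ->].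
apply: (conX (P \o f)) => // u v uX vX uv /=.
by case: (fe u v uX vX uv) => [-> //|]; apply: stepP; exact: imset_f.
Qed.

Lemma acyclic_inj (U W : finType) (G : sgraph U) (H : sgraph W) (f : W -> U) :
  injective f -> {mono f : x y / adj H x y >-> adj G x y} ->
  acyclic G -> acyclic H.
Proof.
move=> f_inj f_mono acG c /andP[cyc_c uniq_c].
rewrite -(size_map f); apply: acG; rewrite /ucycle (map_inj_uniq f_inj) uniq_c andbT.
case: c cyc_c {uniq_c} => //= x p; rewrite -map_rcons path_map.
by apply: sub_path => y z; rewrite /= f_mono.
Qed.

Lemma induced_acyclic (U : finType) (G : sgraph U) (X : {set U}) :
  acyclic G -> acyclic (induced G X).
Proof. exact: (acyclic_inj val_inj). Qed.

(** * Chains of connected sets in a complete rooted tree *)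

(** The [c = count Q s] elements of [Q] cut [s] into [c + 1] blocks of at most [M - 1] elements, and
    [(c + 1) * (M - 1) + c < (c + 1) * M]. *)
Lemma infix_free_size (A : eqType) (Q : pred A) (M : nat) (s : seq A) :
  (forall s', infix s' s -> all (predC Q) s' -> size s' < M) ->
  size s < (count Q s).+1 * M.
Proof.
have [m] := ubnP (size s); elim: m s => // m IH s; rewrite ltnS => s_le freeM.
have [hasQ|] := boolP (has Q s); last first.
  move=> noQ; have := noQ; rewrite has_count -eqn0Ngt => /eqP ->; rewrite mul1n.
  by apply: freeM; rewrite ?infix_refl ?all_predC.
case: (split_find hasQ) s_le freeM => x s1 s2 Qx noQ s_le freeM.
have s1_lt : size s1 < M.
  by apply: freeM; rewrite ?all_predC // cat_rcons prefix_infix.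
have s2_lt : size s2 < (count Q s2).+1 * M.
  apply: IH => [|s' s's2].
    move: s_le; rewrite size_cat size_rcons; apply: leq_trans.
    by rewrite addSn ltnS leq_addl.
  by apply: freeM; apply: infix_catl.
rewrite count_cat -cats1 count_cat /= Qx addn0 addn1 addSn size_cat size_cat addn1.
apply: (@leq_trans (M + (count Q s2).+1 * M)).
  by rewrite -addnS leq_add.
by rewrite -mulSn leq_mul2r; apply/orP; right; rewrite !ltnS leq_addl.
Qed.

(* Splitting the sequence at the at most [b] sets that contain a node [s],
   every remaining block lives below a single child of [s]. *)
Lemma connected_set_seq_size (w h b d : nat) (s : seq 'I_w)
    (Ys : seq {set h.-bseq 'I_w}) :
  d + size s = h.+1 ->
  {in Ys, forall Y : {set h.-bseq 'I_w}, [/\ Y != set0,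
     connected_set (@ary_adj w h) Y & {in Y, forall u : h.-bseq 'I_w, prefix s u}]} ->
  sorted (fun Y Z : {set h.-bseq 'I_w} => Y :&: Z != set0) Ys ->
  (forall u, count (fun Y : {set h.-bseq 'I_w} => u \in Y) Ys <= b) ->
  size Ys < b.+1 ^ d.
Proof.
elim: d s Ys => [|d IH] s Ys dsh YsP sortedYs countYs.
  (* A word of length [h + 1] is a prefix of no node, so [Ys] must be empty. *)
  case: Ys YsP {sortedYs countYs} => // Y Ys /(_ Y (mem_head _ _))[/set0Pn[u uY] _ /(_ u uY)].
  move=> /size_prefix; rewrite add0n in dsh; rewrite dsh => /leq_trans/(_ (size_bseq u)).
  by rewrite ltnn.
have sh : size s <= h by rewrite -ltnS -dsh addSn ltnS leq_addl.
pose u0 : h.-bseq 'I_w := Bseq sh.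
apply: (@leq_trans
  ((count (fun Y : {set h.-bseq 'I_w} => u0 \in Y) Ys).+1 * b.+1 ^ d)); last first.
  by rewrite expnS leq_mul2r ltnS countYs orbT.
apply: infix_free_size => Zs ZsYs freeZs.
have sub : {subset Zs <= Ys} by apply: mem_subseq; exact: infixW.
have sortedZs := infix_sorted ZsYs sortedYs.
have countZs u := leq_trans (leq_count_subseq
  (fun Y : {set h.-bseq 'I_w} => u \in Y) (infixW ZsYs)) (countYs u).
case: Zs => [|Z Zs] in ZsYs freeZs sub sortedZs countZs *; first by rewrite expn_gt0.
(* Only the node [s], which the sets of the block avoid, joins the subtree below [rcons s c] to the
   rest. *)
have below (Y : {set h.-bseq 'I_w}) c : Y \in Z :: Zs ->
    (exists2 u : h.-bseq 'I_w, u \in Y & prefix (rcons s c) u) ->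
    {in Y, forall u : h.-bseq 'I_w, prefix (rcons s c) u}.
  move=> YZ [u uY pu] v vY.
  have [_ conY prefY] := YsP _ (sub _ YZ).
  have u0Y x : x \in Y -> (x : seq _) != s.
    move=> xY; apply: contraNneq (allP freeZs _ YZ) => /= xs.
    by have -> : u0 = x by apply: val_inj.
  apply: (conY (fun x => prefix (rcons s c) x) _ u) => // x y xY yY /orP[] /existsP[c' /eqP eq_xy] px.
    by rewrite eq_xy; apply: prefix_trans px _; exact: prefix_rcons.
  have /prefixP[r yE] := prefY y yY.
  case: r yE => [|c1 r] yE; first by have := u0Y y yY; rewrite yE cats0 eqxx.
  move: px; rewrite eq_xy yE -!cats1 -catA /= !prefix_catr // !eqxx /=.
  by rewrite !prefix0s.
have [/set0Pn[u uZ] _ /(_ u uZ)/prefixP[r uE]] := YsP Z (sub _ (mem_head _ _)).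
case: r uE => [|c r] uE.
  have := allP freeZs _ (mem_head _ _); rewrite /=.
  by have -> : u0 = u; [apply: val_inj; rewrite /= uE cats0 | rewrite uZ].
(* Consecutive sets meet, so the child [c] found for [Z] serves the whole block. *)
have Zc : {in Z :: Zs, forall Y : {set _}, {in Y, forall v : h.-bseq 'I_w, prefix (rcons s c) v}}.
  have base : {in Z, forall v : h.-bseq 'I_w, prefix (rcons s c) v}.
    apply: below; first exact: mem_head.
    by exists u => //; rewrite uE -cats1 prefix_catr // eqxx /= eqxx prefix0s.
  move: sortedZs below base; rewrite /sorted; clear.
  elim: Zs Z => [|Z' Zs IH] Z /= pathZs below base Y.
    by rewrite inE => /eqP ->.
  rewrite inE => /predU1P[-> //|]; case/andP: pathZs => /set0Pn[v /setIP[vZ vZ']] pathZs.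
  apply: IH => // [Y' c' Y'Z|]; first by apply: below; rewrite inE Y'Z orbT.
  by apply: below; [rewrite !inE eqxx orbT | exists v => //; exact: base].
apply: (IH (rcons s c)) => //; first by rewrite size_rcons addnS -addSn.
by move=> Y YZ; have [? ? _] := YsP _ (sub _ YZ); split=> //; exact: Zc.
Qed.

Lemma sub_connected_set (U : finType) (e e' : rel U) (X : {set U}) :
  subrel e e' -> connected_set e X -> connected_set e' X.
Proof. by move=> ee' conX P stepP; apply: conX => x y xX yX /ee'; exact: stepP. Qed.

(** * Growth of the heights *)

Lemma height_ge2 (k j : nat) : 2 <= height k j.
Proof.
case: j => // j; rewrite /height -/(height k j) addn1 ltnS expn_gt0.
by rewrite addn2.
Qed.

Lemma leq_height (k i j : nat) : i <= j -> height k i <= height k j.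
Proof.
elim: j => [|j IH]; first by rewrite leqn0 => /eqP ->.
rewrite leq_eqVlt => /predU1P[-> //|]; rewrite ltnS => /IH/leq_trans; apply.
rewrite [height k j.+1]/height -/(height k j) addn1 ltnW // ltnS ltnW //.
apply: (@leq_trans (2 * height k j)).
  by rewrite -[X in X < _]mul1n ltn_mul2r (ltnW (height_ge2 k j)).
by apply: ltnW; apply: ltn_expl; rewrite addn2.
Qed.

(** Monotonicity reduces this to [j = i + 1], where [2 * height k i] is at least
    [height k i + 1]. *)
Lemma height_gap (k i j : nat) :
  i < j -> (k + 2) ^ (height k i).+1 <= height k j.
Proof.
move=> ij; apply: leq_trans (leq_height k ij).
rewrite [height k i.+1]/height -/(height k i) addn1 ltnW // ltnS leq_exp2l ?addn2 //.
by rewrite mul2n -addnn -addn1 leq_add2l ltnW // height_ge2.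
Qed.

(** * Node sets in the extended graph *)

Section Tilde.
Variables (k n : nat) (V : finType) (G : sgraph V) (a : 'I_n -> V).
Local Notation node := (Tagged (fun i : 'I_n => S_vertex k n i)).
Local Notation root := (tilde_root k).

Lemma tilde_adj_cases (x y : tilde_vertex k n) : adj (tilde k G a) x y ->
  tag x = tag y \/ x = root (tag x) /\ y = root (tag y).
Proof.
by case/orP=> [/andP[/eqP tag_xy _]|/and3P[/eqP xE /eqP yE _]]; [left | right].
Qed.

(** Edges between different trees join two roots, so a connected set leaves the tree of [x] only
    through its root. *)
Lemma connected_root (X : {set tilde_vertex k n}) x y :
  connected_set (adj (tilde k G a)) X -> x \in X -> y \in X ->
  tag x != tag y -> root (tag x) \in X.
Proof.
move=> conX xX yX; apply: contraNT => rootx.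
apply: (conX (fun z => tag x == tag z) _ x) => // u v uX vX uv /eqP xu.
case: (tilde_adj_cases uv) => [<-|[uroot _]]; first exact/eqP.
by case/negP: rootx; rewrite xu -uroot.
Qed.

Variable B : tilde_vertex k n -> {set tilde_vertex k n}.
Hypothesis card_B : forall x, #|B x| <= k.+1.
Hypothesis nodes_neq0 : forall v, bag_nodes B v != set0.
Hypothesis nodes_connected :
  forall v, connected_set (adj (tilde k G a)) (bag_nodes B v).
Hypothesis nodes_meet : forall u v, adj (tilde k G a) u v ->
  bag_nodes B u :&: bag_nodes B v != set0.

Definition interior_upto (j : 'I_n) : {set tilde_vertex k n} :=
  [set x : tilde_vertex k n | (tag x <= j) && (x != root (tag x))].

(** The complement consists of the [n] roots and the trees [S_i] with [i > j], which is what [arity]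
    counts. *)
Lemma card_interior_upto (j : 'I_n) :
  (k + 1) * #|~: interior_upto j| < arity k n j.
Proof.
rewrite arityE // addn1 [X in _ < X]addn1 ltnS leq_mul2l; apply/orP; right.
apply: (@leq_trans (#|[set root i | i : 'I_n]| + #|[set x : tilde_vertex k n | j < tag x]|)).
  apply: leq_trans (leq_card_setU _ _); apply: subset_leq_card.
  apply/subsetP => x; rewrite !inE negb_and -ltnNge negbK => /orP[->|/eqP ->].
    by rewrite orbT.
  by rewrite imset_f.
rewrite leq_add ?(leq_trans (leq_imset_card _ _)) ?card_ord //.
rewrite big_geq_mkord /=.
rewrite -sum1_card.
rewrite (eq_bigl (fun x : tilde_vertex k n => (j < tag x) && true)); last first.
  by move=> x; rewrite inE andbT.
rewrite -(sig_big_dep (fun i : 'I_n => j < i) (fun _ => xpredT) (fun _ _ => 1)) /=.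
by apply: leq_sum => i _; rewrite sum1_card.
Qed.

(** Pigeonhole: otherwise all [arity k n j] children would lie in bags of nodes outside
    [interior_upto j], which have too little room. *)
Lemma exists_interior_child (j : 'I_n) (s : S_vertex k n j) :
  size s < height k j -> exists t : S_vertex k n j,
    ary_child s t /\ bag_nodes B (node t) \subset interior_upto j.
Proof.
move=> s_lt.
have child_lt c : size (rcons s c) <= height k j by rewrite size_rcons.
pose child c : S_vertex k n j := Bseq (child_lt c).
have childP c : ary_child s (child c) by apply/existsP; exists c.
have [c cP|noChild] := pickP (fun c => bag_nodes B (node (child c)) \subset interior_upto j).
  by exists (child c).
have := card_interior_upto j; rewrite ltnNge => /negP[].
have inj_child : injective (fun c => node (child c)).
  by move=> c d /eqP; rewrite eq_Tagged /= => /eqP[/rcons_inj[]].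
rewrite -[X in X <= _]card_ord -(card_imset _ inj_child).
apply: (@leq_trans #|\bigcup_(x in ~: interior_upto j) B x|).
  apply: subset_leq_card; apply/subsetP => _ /imsetP[c _ ->].
  have /subsetPn[x xB xI] := negbT (noChild c).
  by apply/bigcupP; exists x; rewrite ?inE // in xB xI *.
rewrite mulnC -sum_nat_const.
elim/big_rec2: _ => [|x m A _ Am]; first by rewrite cards0.
by apply: leq_trans (leq_card_setU _ _) _; rewrite leq_add // addn1.
Qed.

Lemma exists_interior_path (j : 'I_n) (m : nat) (s : S_vertex k n j) :
  size s + m <= height k j -> exists p : seq (S_vertex k n j),
    [/\ size p = m, path (@ary_child _ _) s p
      & {in p, forall t, bag_nodes B (node t) \subset interior_upto j}].
Proof.
elim: m s => [|m IH] s; first by exists [::].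
rewrite addnS => sm_lt.
have [t [st t_int]] := exists_interior_child (leq_ltn_trans (leq_addr _ _) sm_lt).
have [|p [size_p path_p p_int]] := IH t.
  by case/existsP: (st) => c /eqP ->; rewrite size_rcons.
exists (t :: p); split; rewrite /= ?size_p ?st // => u.
by rewrite inE => /predU1P[->|/p_int].
Qed.

(** Nodes in two different trees would force a root into the node set, but [interior_upto j]
    contains no root. *)
Lemma interior_nodes_tag (j : 'I_n) (v x y : tilde_vertex k n) :
  bag_nodes B v \subset interior_upto j ->
  x \in bag_nodes B v -> y \in bag_nodes B v -> tag x = tag y.
Proof.
move=> /subsetP v_int xv yv; apply/eqP; apply/negPn/negP => tag_xy.
have /v_int := connected_root (@nodes_connected v) xv yv tag_xy.
by rewrite inE eqxx andbF.
Qed.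

(* A path of length [height k j] is too long to be decomposed over [S_i] with
   [i < j], so the nodes of the interior path below [root j] lie in [S_j]. *)
Lemma nodes_root_meet (j : 'I_n) :
  exists2 x, tag x = j & x \in bag_nodes B (root j).
Proof.
have [|[|t0 p] [size_p path_p p_int]] := @exists_interior_path j (height k j) (S_root k n j).
- by rewrite add0n.
- by have := height_ge2 k j; rewrite -size_p.
have root_t0 : adj (tilde k G a) (root j) (node t0).
  rewrite tilde_adj_tree; case/andP: path_p => t0_child _.
  by rewrite /= /ary_adj t0_child.
have /set0Pn[x0 /setIP[x0r x0t]] := nodes_meet root_t0.
have [tag_x0|tag_x0] := eqVneq (tag x0) j; first by exists x0.
have lt_x0j : tag x0 < j.
  rewrite ltn_neqAle tag_x0 /=.
  by have /subsetP/(_ _ x0t) := p_int t0 (mem_head _ _); rewrite inE => /andP[].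
set i := tag x0 in lt_x0j.
(* Each node set on the path stays in one tree and meets the next one, so the index [i] propagates
   from [t0]. *)
have tag_i : {in t0 :: p, forall t, {in bag_nodes B (node t), forall x, tag x = i}}.
  have base : {in bag_nodes B (node t0), forall x, tag x = i}.
    by move=> x xt0; apply: interior_nodes_tag xt0 x0t; exact: p_int (mem_head _ _).
  case/andP: path_p => _; move: p_int base; clear -nodes_connected nodes_meet.
  elim: p t0 => [|t1 p IH] t0 p_int base path_p t; first by rewrite inE => /eqP ->.
  rewrite inE => /predU1P[-> //|].
  case/andP: path_p => t01 path_p.
  have t01_adj : adj (tilde k G a) (node t0) (node t1).
    by rewrite tilde_adj_tree /= /ary_adj t01.
  have /set0Pn[x1 /setIP[x10 x11]] := nodes_meet t01_adj.
  apply: IH => // [u up|x xt1]; first by apply: p_int; rewrite inE up orbT.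
  rewrite -(base _ x10); apply: interior_nodes_tag xt1 x11.
  by apply: p_int; rewrite !inE eqxx orbT.
(* Outside [S_i] the value defaults to the root; by [tag_i] this never occurs for the nodes used
   below. *)
pose f (x : tilde_vertex k n) : S_vertex k n i := tagged_as (root i) x.
have fK x : tag x = i -> node (f x) = x.
  by case: x => l s /= li; rewrite /f; move: s; rewrite li => s; rewrite tagged_asE.
pose Y t := f @: bag_nodes B (@Tagged _ j (fun i : 'I_n => S_vertex k n i) t).
have memY t u : t \in t0 :: p -> u \in Y t -> node t \in B (node u).
  by move=> tp /imsetP[x xt ->]; rewrite fK ?(tag_i t) //; rewrite inE in xt.
suff : size (map Y (t0 :: p)) < k.+2 ^ (height k i).+1.
  rewrite size_map size_p ltnNge -[k.+2]addn2 => /negP[]; exact: height_gap.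
(* Starting from the empty word gives [d = height k i + 1]; the bag size bound gives [b = k + 1]. *)
apply: (@connected_set_seq_size _ _ _ _ [::]); first by rewrite addn0.
- move=> _ /mapP[t tp ->]; split.
  + by have /set0Pn[x xt] := nodes_neq0 (node t); apply/set0Pn; exists (f x); exact: imset_f.
  + apply: connected_set_imset (@nodes_connected (node t)) => x y xt yt.
    rewrite -{1}(fK x) ?(tag_i t) // -{1}(fK y) ?(tag_i t) // tilde_adj_tree.
    by right.
  + by move=> u _; rewrite prefix0s.
- rewrite sorted_map /=; case/andP: path_p => _.
  apply: sub_path => t u tu.
  have tu_adj : adj (tilde k G a) (node t) (node u).
    by rewrite tilde_adj_tree /= /ary_adj tu.
  have /set0Pn[x /setIP[xt xu]] := nodes_meet tu_adj.
  by apply/set0Pn; exists (f x); rewrite inE !imset_f.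
move=> u; rewrite count_map.
apply: leq_trans (card_B (node u)).
(* Depth increases along the path, so the sets containing [u] come from distinct vertices of one
   bag. *)
have uniq_p : uniq (t0 :: p).
  have : path (relpre (fun t : S_vertex k n j => size t) ltn) (S_root k n j) (t0 :: p).
    apply: sub_path path_p => s t /existsP[c /eqP] /=; move->.
    by rewrite size_rcons.
  move=> /path_sorted; apply: sorted_uniq => [y x z|x]; [exact: ltn_trans | exact: ltnn].
rewrite -size_filter; set q := filter _ _.
have uniq_q : uniq q by exact: filter_uniq.
rewrite -(card_uniqP uniq_q).
have inj_node : injective (@Tagged _ j (fun i : 'I_n => S_vertex k n i)).
  by move=> s t /eqP; rewrite eq_Tagged => /eqP.
rewrite -(card_image inj_node); apply: subset_leq_card.
apply/subsetP => _ /imageP[t tq ->]; move: tq; rewrite mem_filter => /andP[uY tp].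
exact: memY tp uY.
Qed.

End Tilde.

(** * Contraction of the trees onto their roots *)

Theorem lemma3p3 (k : nat) (k_gt0 : 0 < k) (V : finType) (G : sgraph V)
    (G_connected : connected G) (n : nat) (a : 'I_n -> V) (a_bij : bijective a)
    (T : sgraph (tilde_vertex k n))
    (B : tilde_vertex k n -> {set tilde_vertex k n})
    (T_spanning : spanning_tree T (tilde k G a))
    (TB_decomposition : tree_decomposition T B (tilde k G a))
    (B_width : width B <= k) :
  exists (T' : sgraph V) (B' : V -> {set V}),
    [/\ spanning_tree T' G,
        tree_decomposition T' B' G,
        width B' <= k + 1
      & forall v : V, v \in bag_nodes B' v].
Proof.
have [[T_conn T_acyc] T_sub] := T_spanning.
have [_ nodesP nodes_meet] := TB_decomposition.
have card_B x : #|B x| <= k.+1.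
  apply: leq_trans (leq_bigmax (F := fun x => #|B x|) x) _.
  by move: B_width; rewrite /width; case: (\max_(x : _) _).
have nodesT v : connected_set (adj T) (bag_nodes B v).
  by have [_ [/connected_setP]] := nodesP v.
have nodesG v := sub_connected_set T_sub (nodesT v).
have rootP := nodes_root_meet card_B (fun v => (nodesP v).1) nodesG nodes_meet.
have [b aK bK] := a_bij.
pose r v := tilde_root k (b v).
pose proj (x : tilde_vertex k n) := a (tag x).
have projK v : proj (r v) = v by rewrite /proj bK.
have r_inj : injective r by exact: can_inj projK.
have adj_r u v : adj (tilde k G a) (r u) (r v) = adj G u v by rewrite tilde_adj_root !bK.
have T'_sym : symmetric (fun u v => adj T (r u) (r v)) by move=> u v; exact: adj_sym.
have T'_irr : irreflexive (fun u v => adj T (r u) (r v)) by move=> u; exact: adj_irr.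
pose T' := SGraph T'_sym T'_irr.
have proj_edge x y : adj T x y -> proj x = proj y \/ adj T' (proj x) (proj y).
  move=> xy; case: (tilde_adj_cases (T_sub _ _ xy)) => [tag_xy|[xE yE]].
    by left; rewrite /proj tag_xy.
  by right; rewrite /= /r /proj !aK -xE -yE.
have T'_tree : is_tree T'.
  split; last by apply: (acyclic_inj r_inj) T_acyc.
  apply/connected_setTP.
  have -> : [set: V] = proj @: [set: tilde_vertex k n].
    by apply/esym/setP => v; rewrite inE -(projK v) imset_f.
  apply: connected_set_imset => [x y _ _|]; first exact: proj_edge.
  exact/connected_setTP.
pose B' v := v |: [set u | r u \in B (r v)].
have B'P u v : (v \in bag_nodes B' u) = (u == v) || (r v \in bag_nodes B (r u)).
  by rewrite !inE.
(* [rootP] supplies a node inside the tree of [v], so a node set reaching another tree crosses the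
   roots of both trees. *)
have own_root v y : y \in bag_nodes B (r v) -> tag y != b v -> r v \in bag_nodes B (r v).
  move=> yv tag_y; have [x tag_x xv] := rootP (b v).
  by have := connected_root (nodesG (r v)) xv yv; rewrite tag_x eq_sym; exact.
have other_root v y : y \in bag_nodes B (r v) -> tag y != b v ->
    tilde_root k (tag y) \in bag_nodes B (r v).
  move=> yv tag_y; have [x tag_x xv] := rootP (b v).
  by apply: (connected_root (nodesG (r v)) yv xv); rewrite tag_x.
have own v u : r u \in bag_nodes B (r v) -> r v \in bag_nodes B (r v).
  have [-> //|uv] := eqVneq u v; move=> ruv; apply: own_root ruv _.
  by rewrite /= (can_eq bK).
exists T', B'; split.
- by split=> // u v; rewrite -adj_r; exact: T_sub.
- split=> //.
  + move=> v; split; first by apply/set0Pn; exists v; rewrite B'P eqxx.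
    split; last by apply: induced_acyclic; case: T'_tree.
    apply/connected_setP.
    have [rv|rv] := boolP (r v \in bag_nodes B (r v)).
      (* Nodes in the tree of [v] project to [v]; for any other node, the root of its tree is a node
         as well. *)
      have -> : bag_nodes B' v = proj @: bag_nodes B (r v).
        apply/setP => u; rewrite B'P; apply/orP/imsetP => [[/eqP <-|ru]|[x xv ->]].
        - by exists (r v).
        - by exists (r u).
        - have [tag_x|tag_x] := eqVneq (tag x) (b v); first by left; rewrite /proj tag_x bK.
          by right; rewrite /r /proj aK; exact: other_root.
      by apply: connected_set_imset (nodesT _) => x y _ _; exact: proj_edge.
    (* By [own], no root at all is a node of [r v] here, so only the added [v] remains. *)
    have -> : bag_nodes B' v = [set v].
      apply/setP => u; rewrite B'P inE eq_sym; case: eqP => //= _.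
      by apply: contraNF rv; exact: own.
    by move=> P _ x y /set1P -> /set1P ->.
  + move=> u v uv; rewrite -adj_r in uv.
    have /set0Pn[x /setIP[xu xv]] := nodes_meet _ _ uv.
    have in_bag w : x \in bag_nodes B (r w) -> proj x \in bag_nodes B' w.
      move=> xw; rewrite B'P; have [tag_x|tag_x] := eqVneq (tag x) (b w).
        by rewrite /proj tag_x bK eqxx.
      by rewrite /r /proj aK other_root ?orbT.
    by apply/set0Pn; exists (proj x); rewrite inE !in_bag.
- rewrite /width addn1 -[X in X.-1 <= _]/(\max_(v : V) #|B' v|).
  rewrite -subn1 leq_subLR add1n; apply/bigmax_leqP => v _.
  rewrite (leq_trans (leq_card_setU _ _)) // cards1 add1n ltnS.
  apply: leq_trans (card_B (r v)).
  rewrite -(card_imset _ r_inj); apply: subset_leq_card.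
  by apply/subsetP => _ /imsetP[u ruv ->]; rewrite inE in ruv.
- by move=> v; rewrite B'P eqxx.
Qed.
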